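(* Let $n\ge 3$ be an integer and $m=n-2$. Under uniform transmission over the binary $2$-deletion channel with input length $n$, among all ${\boldsymbol y}\in\{0,1\}^m$ the input entropy $\mathsf{H}^{\mathsf{In}}_{2\text{-}\mathsf{Del}}({\boldsymbol y})$ is minimized only by ${\boldsymbol y}=0^m$ and ${\boldsymbol y}=1^m$, and $$\min_{{\boldsymbol y}\in\{0,1\}^m}\mathsf{H}^{\mathsf{In}}_{2\text{-}\mathsf{Del}}({\boldsymbol y}) = 2+\frac34\log_2\binom{m+2}{2}-\frac12\log_2(m+1).$$
   Context: For binary sequences ${\boldsymbol x}$ of length $N$ and ${\boldsymbol y}$ of length $\ell\le N$, the embedding number $\omega_{{\boldsymbol y}}({\boldsymbol x})$ is the number of index tuples $1\le i_1<\dots<i_\ell\le N$ with $x_{i_j}=y_j$ for all $j$. The $k$-deletion channel with input length $n$ maps ${\boldsymbol x}\in\{0,1\}^n$ to ${\boldsymbol y}\in\{0,1\}^{n-k}$ with probability $\Pr\{{\boldsymbol y}\mid{\boldsymbol x}\}=\omega_{{\boldsymbol y}}({\boldsymbol x})/\binom{n}{k}$. Under uniform transmission $X$ is uniform on $\{0,1\}^n$, and $\mathsf{H}^{\mathsf{In}}_{k\text{-}\mathsf{Del}}({\boldsymbol y})=H(X\mid Y={\boldsymbol y})=-\sum_{{\boldsymbol x}}P({\boldsymbol x}\mid{\boldsymbol y})\log_2 P({\boldsymbol x}\mid{\boldsymbol y})$ with $P({\boldsymbol x}\mid {\boldsymbol y})=\Pr\{{\boldsymbol y}\mid{\boldsymbol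 x}\}/\sum_{{\boldsymbol x}'}\Pr\{{\boldsymbol y}\mid{\boldsymbol x}'\}$. $0^m$, $1^m$ denote the constant sequences of length $m$. *)

(* Defs.v *)
From HB Require Import structures.
From mathcomp Require Import all_boot all_order all_algebra.
From mathcomp Require Import all_classical all_reals all_analysis.
Set Implicit Arguments. Unset Strict Implicit. Unset Printing Implicit Defensive.
Import Order.TTheory GRing.Theory Num.Theory.
Local Open Scope ring_scope.

Definition bvec (N : nat) := {ffun 'I_N -> bool}.

Definition embed_num (N l : nat) (y : bvec l) (x : bvec N) : nat :=
  #|[set f : {ffun 'I_l -> 'I_N} |
      [forall i : 'I_l, forall j : 'I_l, (i < j)%N ==> (f i < f j)%N]
      && [forall j : 'I_l, x (f j) == y j]]|.

Definition log2 {R : realType} (x : R) : R := ln x / ln 2.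

Definition del_prob {R : realType} (n k : nat) (x : bvec n) (y : bvec (n - k)) : R :=
  (embed_num (N:=n) (l:=n-k) y x)%:R / ('C(n, k))%:R.

(* posterior P(x | y) under uniform input *)
Definition post_prob {R : realType} (n k : nat) (y : bvec (n - k)) (x : bvec n) : R :=
  del_prob (n:=n) (k:=k) x y / \sum_(x' : bvec n) del_prob (n:=n) (k:=k) x' y.

Definition input_entropy {R : realType} (n k : nat) (y : bvec (n - k)) : R :=
  - \sum_(x : bvec n)
      (let p : R := post_prob (n:=n) (k:=k) y x in if p == 0 then 0 else p * log2 p).

Definition zeros (m : nat) : bvec m := [ffun _ => false].
Definition ones (m : nat) : bvec m := [ffun _ => true].

(* Main.v *)
Require Import Defs.
From HB Require Import structures.
From mathcomp Require Import all_boot all_order all_algebra.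
From mathcomp Require Import zify ring lra.
From mathcomp Require Import all_classical all_reals all_analysis.
Import Order.TTheory GRing.Theory Num.Theory.
Local Open Scope ring_scope.

(** Write [w x] for the embedding number of [y] in [x], [m] for the length of
    [y], [b = m + 1], [c = 'C(m + 2, 2)] and [f t = t ln t].  The posterior is
    [w x / (4 c)], so minimizing the entropy means maximizing [\sum_x f (w x)].
    Neither [\sum_x w x] nor the number of [x] with [w x > 0] depends on [y],
    and [\sum_x max (w x - b, 0) <= c - b] by induction on [y].  On the integers
    [1, ..., c], convexity puts [f] below the broken line through its graph at
    [1], [b] and [c]; summing the broken line over all [x] and using these three
    facts bounds [\sum_x f (w x)] by its value at a constant [y], for which [w]
    only takes the values [0, 1, b, c].  Equality forces [w x = c] for some [x],
    and then [y] is constant. *)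

(** * First letter and tail of a binary sequence *)

Definition bcons {N} (a : bool) (x : bvec N) : bvec N.+1 :=
  [ffun i => if unlift ord0 i is Some j then x j else a].

Definition btail {N} (x : bvec N.+1) : bvec N := [ffun i => x (lift ord0 i)].

Lemma bcons0 {N} a (x : bvec N) : bcons a x ord0 = a.
Proof. by rewrite ffunE unlift_none. Qed.

Lemma bconsK {N} a (x : bvec N) : btail (bcons a x) = x.
Proof. by apply/ffunP => i; rewrite !ffunE liftK. Qed.

Lemma btailK {N} (x : bvec N.+1) : bcons (x ord0) (btail x) = x.
Proof.
apply/ffunP => i; rewrite !ffunE.
by case: unliftP => [j ->|->//]; rewrite ffunE.
Qed.

Lemma sum_bvecS {N} (F : bvec N.+1 -> nat) :
  (\sum_x F x = \sum_a \sum_x F (bcons a x))%N.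
Proof.
rewrite pair_big /= (reindex (fun p => bcons p.1 p.2)) //=.
exists (fun x : bvec N.+1 => (x ord0, btail x)) => [[a x] _|x _] /=.
  by rewrite bcons0 bconsK.
exact: btailK.
Qed.

(** * Embeddings and their recursion on first letters *)

Definition embeddings {N l} (y : bvec l) (x : bvec N) : {set {ffun 'I_l -> 'I_N}} :=
  [set f : {ffun 'I_l -> 'I_N} |
    [forall i : 'I_l, forall j : 'I_l, (i < j)%N ==> (f i < f j)%N]
    && [forall j : 'I_l, x (f j) == y j]].

Lemma embed_numE {N l} (y : bvec l) (x : bvec N) :
  embed_num y x = #|embeddings y x|.
Proof. by []. Qed.

Lemma embeddingsP {N l} (y : bvec l) (x : bvec N) (f : {ffun 'I_l -> 'I_N}) :
  reflect ((forall i j : 'I_l, (i < j)%N -> (f i < f j)%N) /\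
           forall j, x (f j) = y j) (f \in embeddings y x).
Proof.
rewrite inE; apply: (iffP andP) => -[inc hf]; split.
- by move=> i j; have /forallP/(_ i)/forallP/(_ j)/implyP := inc.
- by move=> j; apply/eqP; have /forallP := hf.
- by apply/forallP => i; apply/forallP => j; apply/implyP; apply: inc.
- by apply/forallP => j; apply/eqP.
Qed.

Lemma embed_num0 {N} (y : bvec 0) (x : bvec N) : embed_num y x = 1%N.
Proof.
transitivity #|[set: {ffun 'I_0 -> 'I_N}]|; last by rewrite cardsT card_ffun !card_ord expn0.
by rewrite embed_numE; apply: eq_card => f; rewrite [RHS]inE; apply/embeddingsP; split=> -[].
Qed.

(** An embedding either avoids position [ord0] of [x] or sends the first index there; [skip] and
    [use] parametrize the two cases by embeddings into [btail x]. *)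
Lemma embed_numS {N l} (y : bvec l.+1) (x : bvec N.+1) :
  embed_num y x = (embed_num y (btail x) +
    (x ord0 == y ord0) * embed_num (btail y) (btail x))%N.
Proof.
pose skip (g : {ffun 'I_l.+1 -> 'I_N}) : {ffun 'I_l.+1 -> 'I_N.+1} :=
  [ffun j => lift ord0 (g j)].
pose use (g : {ffun 'I_l -> 'I_N}) : {ffun 'I_l.+1 -> 'I_N.+1} :=
  [ffun j => if unlift ord0 j is Some i then lift ord0 (g i) else ord0].
have skip_inj : injective skip.
  move=> g h /ffunP e; apply/ffunP => j.
  by have := e j; rewrite !ffunE => /lift_inj.
have use_inj : injective use.
  move=> g h /ffunP e; apply/ffunP => j.
  by have := e (lift ord0 j); rewrite !ffunE !liftK => /lift_inj.
rewrite !embed_numE -(cardsID [set f : {ffun 'I_l.+1 -> 'I_N.+1} | f ord0 != ord0]).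
congr (_ + _)%N.
  rewrite -(card_imset _ skip_inj); apply: eq_card => f.
  rewrite finset.in_setI [X in _ && X]inE; apply/andP/imsetP.
    move=> [/embeddingsP[inc hf] f0].
    (* Being increasing, [f] avoids [ord0] everywhere once it does so at the first index, hence it
       factors through [lift ord0]. *)
    have /fin_all_exists[g hg] : forall j, exists i, f j = lift ord0 i.
      move=> j; case: (unliftP ord0 (f j)) => [i ->|fj0]; first by exists i.
      have [->|j0] := eqVneq j ord0.
        by case: (unliftP ord0 (f ord0)) f0 => [i -> _|-> /eqP//]; exists i.
      have lt0j : (@ord0 l < j)%N by rewrite lt0n.
      by have := inc _ _ lt0j; rewrite fj0.
    exists (finfun g); last by apply/ffunP => j; rewrite !ffunE.
    apply/embeddingsP; split=> [i j ij|j].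
      by have := inc _ _ ij; rewrite !hg !ffunE /= /bump /= !add1n.
    by rewrite !ffunE -hg.
  case=> g /embeddingsP[inc hg] ->; split; last by rewrite ffunE.
  apply/embeddingsP; split=> [i j ij|j].
    by rewrite !ffunE /= /bump /= !add1n; apply: inc.
  by have := hg j; rewrite !ffunE.
have [xy|xy] := eqVneq (x ord0) (y ord0); last first.
  rewrite mul0n; apply: eq_card0 => f.
  rewrite finset.in_setD [X in ~~ X]inE negbK; apply/andP => -[/eqP f0 /embeddingsP[_ hf]].
  by move: xy; rewrite -(hf ord0) f0 eqxx.
rewrite mul1n -(card_imset _ use_inj); apply: eq_card => f.
rewrite finset.in_setD [X in ~~ X]inE negbK; apply/andP/imsetP.
  move=> [/eqP f0 /embeddingsP[inc hf]].
  have /fin_all_exists[g hg] : forall j, exists i, f (lift ord0 j) = lift ord0 i.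
    move=> j; case: (unliftP ord0 (f (lift ord0 j))) => [i ->|fj0]; first by exists i.
    have lt0j : (@ord0 l < lift ord0 j)%N by [].
    by have := inc _ _ lt0j; rewrite fj0.
  exists (finfun g); last first.
    apply/ffunP => j; rewrite !ffunE; case: unliftP => [i ->|->//].
    by rewrite ffunE.
  apply/embeddingsP; split=> [i j ij|j].
    have lt_ij : (@lift l.+1 ord0 i < @lift l.+1 ord0 j)%N by [].
    by have := inc _ _ lt_ij; rewrite !hg !ffunE.
  by rewrite !ffunE -hg.
case=> g /embeddingsP[inc hg] ->; split; first by rewrite ffunE unlift_none.
apply/embeddingsP; split=> [i j|j]; rewrite !ffunE.
  case: (unliftP ord0 j) => [j' ->|->//].
  case: (unliftP ord0 i) => [i' ->|->//].
  exact: inc.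
by case: (unliftP ord0 j) => [j' ->|->//]; have := hg j'; rewrite !ffunE.
Qed.

Lemma embed_num_gt {l} (y : bvec l.+1) (x : bvec 0) : embed_num y x = 0%N.
Proof. by rewrite embed_numE; apply: eq_card0 => f; case: (f ord0). Qed.

Lemma embed_num_bcons {N l} (y : bvec l.+1) a (x : bvec N) :
  embed_num y (bcons a x) =
    (embed_num y x + (a == y ord0) * embed_num (btail y) x)%N.
Proof. by rewrite embed_numS bcons0 bconsK. Qed.

(** * Counts and bounds for embedding numbers *)

(** Any [l] positions carry [y] in [2 ^ (N - l)] sequences; the factor [2 ^ l] avoids the
    subtraction and keeps the identity true for [l > N]. *)
Lemma sum_embed_num N l (y : bvec l) :
  (\sum_(x : bvec N) embed_num y x * 2 ^ l = 'C(N, l) * 2 ^ N)%N.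
Proof.
elim: N l y => [|N IH] [|l] y.
- by rewrite (eq_bigr (fun=> 1%N)) ?sum1_card ?card_ffun ?card_ord // => x _; rewrite embed_num0.
- by rewrite big1 // => x _; rewrite embed_num_gt.
- rewrite (eq_bigr (fun=> 1%N)); last by move=> x _; rewrite embed_num0.
  by rewrite sum1_card card_ffun card_ord card_bool bin0 mul1n.
rewrite -big_distrl /= sum_bvecS.
have -> : (\sum_a \sum_(x : bvec N) embed_num y (bcons a x) =
    2 * (\sum_(x : bvec N) embed_num y x) + \sum_(x : bvec N) embed_num (btail y) x)%N.
  have step a : (\sum_(x : bvec N) embed_num y (bcons a x) =
      \sum_(x : bvec N) embed_num y x +
      (a == y ord0) * \sum_(x : bvec N) embed_num (btail y) x)%N.
    by under eq_bigr do rewrite embed_num_bcons; rewrite big_split big_distrr.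
  by rewrite big_bool /= !step; case: (y ord0) => /=; lia.
move: (IH l.+1 y) (IH l (btail y)); rewrite -!big_distrl /= binS !expnS => H1 H2.
set A := (\sum_i embed_num y i)%N in H1 *; set B := (\sum_i _)%N in H2 *.
nia.
Qed.

(** Embedding a constant sequence means choosing [l] of the positions of [x] that carry [b]. *)
Lemma embed_num_const N l b (x : bvec N) :
  embed_num (l := l) [ffun=> b] x = 'C(\sum_i (x i == b), l) :> nat.
Proof.
elim: N l x => [|N IH] [|l] x; rewrite ?embed_num0 ?bin0 //.
  by rewrite embed_num_gt big_ord0.
have tl : btail [ffun _ : 'I_l.+1 => b] = [ffun=> b].
  by apply/ffunP => i; rewrite !ffunE.
have -> : (\sum_i (x i == b) = (x ord0 == b) + \sum_i (btail x i == b))%N.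
  by rewrite big_ord_recl; congr addn; apply: eq_bigr => i _; rewrite ffunE.
rewrite embed_numS tl !IH ffunE; case: (_ == b); rewrite ?add1n ?add0n ?addn0 //.
by rewrite binS mul1n.
Qed.

(** Every embedding is increasing, and all increasing maps embed [zeros l] into [zeros N]. *)
Lemma leq_embed_num_bin {N l} (y : bvec l) (x : bvec N) : (embed_num y x <= 'C(N, l))%N.
Proof.
have <- : embed_num (zeros l) (zeros N) = 'C(N, l).
  rewrite embed_num_const; under eq_bigr do rewrite ffunE eqxx.
  by rewrite sum1_card card_ord.
rewrite !embed_numE; apply/subset_leq_card/fintype.subsetP => f /embeddingsP[inc _].
by apply/embeddingsP; split=> // j; rewrite !ffunE.
Qed.

Lemma leq_embed_num_btail {N l} (y : bvec l) (x : bvec N.+1) :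
  (embed_num y (btail x) <= embed_num y x)%N.
Proof.
by case: l y => [|l] y; rewrite ?embed_num0 // [leqRHS]embed_numS leq_addr.
Qed.

Lemma embed_num_btail_gt0 {N l} (y : bvec l.+1) (x : bvec N) :
  (0 < embed_num y x)%N -> (0 < embed_num (btail y) x)%N.
Proof.
elim: N x => [|N IH] x; first by rewrite embed_num_gt.
rewrite embed_numS addn_gt0 muln_gt0 => /orP[/IH|/andP[_]] h;
  exact: leq_trans h (leq_embed_num_btail _ _).
Qed.

(** [bcons a x] contains [y] exactly when [x] contains [btail y], if [a] is the first letter of [y],
    and exactly when [x] contains [y] otherwise. Pascal's rule adds the two counts. *)
Lemma sum_embed_num_gt0 N l (y : bvec l) :
  (\sum_(x : bvec N) (0 < embed_num y x) = \sum_(l <= i < N.+1) 'C(N, i))%N.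
Proof.
elim: N l y => [|N IH] [|l] y; last 1 first.
- rewrite big_add1 /=; under [RHS]eq_bigr do rewrite binS.
  rewrite big_split /= -(IH _ (btail y)).
  have -> : (\sum_(l <= i < N.+1) 'C(N, i.+1) = \sum_(l.+1 <= i < N.+1) 'C(N, i))%N.
    have [lN|Nl] := leqP l N; last by rewrite !big_geq // ltnW.
    transitivity (\sum_(l.+1 <= i < N.+2) 'C(N, i))%N; first by rewrite big_add1.
    by rewrite big_nat_recr //= bin_small ?addn0.
  rewrite -(IH _ y) sum_bvecS big_bool /= -!big_split /=; apply: eq_bigr => x _.
  rewrite !embed_num_bcons; have := embed_num_btail_gt0 y x.
  case: (y ord0) => /=; case: (embed_num y x) => [|e] h;
    rewrite ?mul0n ?mul1n ?addn0 ?add0n ?addSn //; by rewrite h.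
- by rewrite big_nat1; under eq_bigr do rewrite embed_num0; rewrite sum1_card card_ffun card_ord.
- by rewrite big_geq // big1 // => x _; rewrite embed_num_gt.
under [LHS]eq_bigr do rewrite embed_num0; rewrite sum1_card card_ffun card_ord card_bool.
rewrite big_mkord -[2%N]/(1 + 1)%N expnDn; apply: eq_bigr => i _.
by rewrite !exp1n !muln1.
Qed.

(** * Excess of embedding numbers over a threshold *)

(** Truncated [w - 1] is [w] minus the indicator of [0 < w], so the sum is [2 * l.+1 - l.+2]. *)
Lemma sum_embed_num_excess1 l (y : bvec l) :
  (\sum_(x : bvec l.+1) (embed_num y x - 1) = l)%N.
Proof.
have hS := sum_embed_num_gt0 l.+1 l y.
have hT := sum_embed_num l.+1 l y.
have : (\sum_(x : bvec l.+1) (embed_num y x - 1) +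
       \sum_(x : bvec l.+1) (0 < embed_num y x) = \sum_(x : bvec l.+1) embed_num y x)%N.
  by rewrite -big_split /=; apply: eq_bigr => x _; case: (embed_num _ _) => // e; rewrite subn1 addn1.
move: hT; rewrite -big_distrl /= expnS mulnA => /eqP.
rewrite eqn_pmul2r ?expn_gt0 // => /eqP ->.
rewrite hS big_nat_recr // big_nat_recr //= big_geq // add0n binn -bin_sub // subSnn bin1.
lia.
Qed.

(* Only the [x] that share the first letter of [y] contribute, the others having
   embedding number at most [l.+1].  If [e1] and [e2] are the two terms of
   [embed_num_bcons], truncated subtraction satisfies
   [e1 + e2 - l.+1 <= (e1 - 1) + (e2 - l)]. *)
Lemma sum_embed_num_excess2 l (y : bvec l) :
  (\sum_(x : bvec l.+2) (embed_num y x - l.+1) <= 'C(l.+1, 2))%N.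
Proof.
elim: l y => [|l IH] y.
  by rewrite big1 // => x _; rewrite embed_num0.
rewrite sum_bvecS (bigD1 (y ord0)) //= [X in (_ + X)%N]big1 ?addn0; last first.
  move=> a ay; apply: big1 => x _; apply/eqP; rewrite subn_eq0 embed_num_bcons.
  by rewrite (negbTE ay) addn0 -[leqRHS]bin1 -bin_sub // subn1 leq_embed_num_bin.
(* In Pascal's rule for ['C(l.+2, 2)], the term [l.+1] is the total excess of [y] over [1], and
   ['C(l.+1, 2)] comes from the induction hypothesis for [btail y]. *)
rewrite binS bin1 addnC -[X in (X + _)%N](sum_embed_num_excess1 _ y).
apply: leq_trans (leq_add (leqnn _) (IH (btail y))); rewrite -big_split /=.
apply: leq_sum => x _; rewrite embed_num_bcons eqxx mul1n; lia.
Qed.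

(** * Embedding numbers and constant sequences *)

(** At the maximum every increasing map is an embedding. The maps [j -> j] and [j -> j + 1] then
    give [y j = x j = x (j + 1)], so [y] is constant. *)
Lemma embed_num_full {l} (y : bvec l) (x : bvec l.+2) :
  embed_num y x = 'C(l.+2, l) -> y = zeros l \/ y = ones l.
Proof.
move=> full.
have zero : embed_num (zeros l) (zeros l.+2) = 'C(l.+2, l).
  rewrite embed_num_const; under eq_bigr do rewrite ffunE eqxx.
  by rewrite sum1_card card_ord.
have sub : embeddings y x = embeddings (zeros l) (zeros l.+2).
  apply/eqP; rewrite eqEcard; apply/andP; split; last first.
    by rewrite -!embed_numE full zero.
  apply/fintype.subsetP => f /embeddingsP[inc _].
  by apply/embeddingsP; split=> // j; rewrite !ffunE.
have shift e : (e <= 1)%N -> forall j : 'I_l, y j = x (inord (j + e)).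
  move=> e1 j; pose f : {ffun 'I_l -> 'I_l.+2} := [ffun i : 'I_l => inord (i + e)].
  have fE i : f i = (i + e)%N :> nat by rewrite ffunE inordK //; have := ltn_ord i; lia.
  have /embeddingsP[_ /(_ j) <-] : f \in embeddings y x.
    rewrite sub; apply/embeddingsP; split=> [i k|i]; last by rewrite !ffunE.
    by rewrite !fE ltn_add2r.
  by rewrite ffunE.
have xE k : (k <= l)%N -> x (inord k) = x (inord 0).
  elim: k => // k IH kl; rewrite -IH; last exact: ltnW.
  by have := shift 1%N isT (Ordinal kl); rewrite (shift 0%N isT) addn0 addn1.
have yE j : y j = x (inord 0) by rewrite (shift 0%N isT) addn0 xE // ltnW.
case: (x (inord 0)) yE => yE; [right|left]; apply/ffunP => j; by rewrite yE ffunE.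
Qed.

Lemma embed_num_const_values {l} b (x : bvec l.+2) :
  embed_num (l := l) [ffun=> b] x \in [:: 0; 1; l.+1; 'C(l.+2, 2)]%N.
Proof.
rewrite embed_num_const !inE.
have : (\sum_i (x i == b) <= l.+2)%N.
  by rewrite -[leqRHS]card_ord -sum1_card; apply: leq_sum => i _; case: (_ == _).
set c := (\sum_i _)%N; rewrite leq_eqVlt => /predU1P[->|].
  by rewrite -[X in 'C(_, X)](addnK 2 l) addn2 bin_sub // eqxx !orbT.
rewrite ltnS leq_eqVlt => /predU1P[->|].
  by rewrite binSn eqxx !orbT.
rewrite ltnS leq_eqVlt => /predU1P[->|lt_cl]; first by rewrite binn.
by rewrite bin_small.
Qed.

(** * Convexity of [t ln t] and its two chords *)

Definition xlnx {R : realType} (x : R) : R := x * ln x.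

(** This is [ln t + 1 < t] at [t = a / c], multiplied by [c]. *)
Lemma xlnx_tangent {R : realType} {a c : R} :
  0 < a -> 0 < c -> a != c -> (ln a + 1) * (c - a) < xlnx c - xlnx a.
Proof.
move=> a0 c0 ac; have ca0 : 0 < a / c by rewrite divr_gt0.
have : ln (a / c) + 1 < a / c.
  rewrite -[X in _ < X]lnK ?posrE // addrC expR_gt1Dx //.
  by rewrite ln_eq0 // -subr_eq0 -(mulfV (lt0r_neq0 c0)) -mulrBl mulf_neq0
    ?subr_eq0 // invr_eq0 lt0r_neq0.
rewrite ln_div ?posrE // ltr_pdivlMr // /xlnx => h; nra.
Qed.

(** The slope of the tangent at [b] lies strictly between those of the two chords. *)
Lemma xlnx_chord {R : realType} {a b c : R} : 0 < a -> a < b -> b < c ->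
  (xlnx b - xlnx a) * (c - b) < (xlnx c - xlnx b) * (b - a).
Proof.
move=> a0 ab bc; have b0 := lt_trans a0 ab; have c0 := lt_trans b0 bc.
have hc := xlnx_tangent b0 c0 (negbT (lt_eqF bc)).
have ha := xlnx_tangent b0 a0 (negbT (gt_eqF ab)).
have : (xlnx b - xlnx a) * (c - b) < (ln b + 1) * (b - a) * (c - b).
  by rewrite ltr_pM2r ?subr_gt0 //; lra.
move/lt_trans; apply; rewrite mulrAC ltr_pM2r ?subr_gt0 //.
Qed.

Section TwoChords.
Variables (R : realType) (b c : nat).
Hypotheses (b1 : (1 < b)%N) (bc : (b < c)%N).

Let f (n : nat) : R := xlnx n%:R.

Definition slope1 : R := f b / (b - 1)%N%:R.
(** The jump of the slope at [b], not the slope of the second chord. *)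
Definition slope2 : R := (f c - f b) / (c - b)%N%:R - slope1.

(** The broken line, extended by [0] at [w = 0]. Writing [w - (0 < w)] for truncated [w - 1] lets
    the first term sum to quantities independent of [y]. *)
Let chords (w : nat) : R := slope1 * (w - (0 < w))%N%:R + slope2 * (w - b)%N%:R.

Let f1 : f 1 = 0. Proof. by rewrite /f /xlnx ln1 mulr0. Qed.

Let chord (i j k : nat) : (0 < i)%N -> (i < j)%N -> (j < k)%N ->
  (f j - f i) * (k%:R - j%:R) < (f k - f j) * (j%:R - i%:R).
Proof. by move=> *; apply: xlnx_chord; rewrite ?ltr0n ?ltr_nat. Qed.

Lemma slope2_gt0 : 0 < slope2.
Proof.
have := chord 1 b c isT b1 bc; rewrite f1 subr0 => h.
rewrite subr_gt0 ltr_pdivrMr ?ltr0n ?subn_gt0 // mulrAC.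
by rewrite ltr_pdivlMr ?ltr0n ?subn_gt0 // !natrB // ltnW.
Qed.

Lemma xlnx_eq_chords w : w \in [:: 0; 1; b; c]%N -> f w = chords w.
Proof.
have b10 : (b - 1)%N%:R != 0 :> R by rewrite pnatr_eq0 -lt0n subn_gt0.
have cb0 : (c - b)%N%:R != 0 :> R by rewrite pnatr_eq0 -lt0n subn_gt0.
rewrite /chords !inE => /or4P[]/eqP->.
- by rewrite /f /xlnx mul0r !sub0n !mulr0 addr0.
- by rewrite f1 subnn (eqP (ltnW b1)) !mulr0 addr0.
- by rewrite subnn mulr0 addr0 (ltnW b1) divfK.
have c0 : (0 < c)%N by lia.
rewrite c0 mulrBl divfK // (_ : (c - 1 = (b - 1) + (c - b))%N); last by lia.
by rewrite natrD mulrDr divfK //; ring.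
Qed.

Lemma xlnx_lt_chords w : (b < w < c)%N -> f w < chords w.
Proof.
move=> /andP[bw wc]; have b10 : 0 < (b - 1)%N%:R :> R by rewrite ltr0n subn_gt0.
have cb0 : 0 < (c - b)%N%:R :> R by rewrite ltr0n subn_gt0.
have := chord b w c (ltnW b1) bw wc.
(* Beyond [b] the two terms merge into the line through the points at [b] and [c]. *)
have -> : chords w = f b + (f c - f b) / (c - b)%N%:R * (w - b)%N%:R.
  have w0 : (0 < w)%N by lia.
  rewrite /chords w0 (_ : (w - 1 = (b - 1) + (w - b))%N); last by lia.
  by rewrite natrD mulrDr /slope2 mulrBl {1}/slope1 divfK ?lt0r_neq0 //; ring.
rewrite -ltrBlDl mulrAC ltr_pdivlMr // !natrB ?(ltnW bw) ?(ltnW bc) // => h; nra.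
Qed.

Lemma xlnx_le_chords w : (w <= c)%N -> f w <= chords w.
Proof.
move=> wc; have [/xlnx_eq_chords->//|] := boolP (w \in [:: 0; 1; b; c]%N).
rewrite !inE !negb_or => /and4P[w0 w1 wb wc'].
have [bw|] := ltnP b w.
  by apply/ltW/xlnx_lt_chords; rewrite bw ltn_neqAle wc'.
rewrite leq_eqVlt (negbTE wb) /= => lt_wb.
have lt1w : (1 < w)%N by lia.
have := chord 1 w b isT lt1w lt_wb; rewrite f1 subr0 => h.
rewrite /chords (eqP (ltnW lt_wb)) mulr0 addr0 (ltnW lt1w) mulrAC.
rewrite ler_pdivlMr ?ltr0n ?subn_gt0 // !natrB ?(ltnW b1) ?(ltnW lt1w) //.
by rewrite -[true%:R]/(1 : R); nra.
Qed.

End TwoChords.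

(** * Maximizing the sum of [w ln w] *)

(** [bound] is the value at a constant [y]: one [x] has embedding number ['C(l.+2, 2)], [l.+2]
    others have [l.+1], and the values [0] and [1] contribute nothing. *)
Lemma sum_xlnx_embed_num (R : realType) l (y : bvec l) : (0 < l)%N ->
  let bound : R := xlnx ('C(l.+2, 2))%:R + l.+2%:R * xlnx l.+1%:R in
  \sum_(x : bvec l.+2) xlnx (embed_num y x)%:R <= bound /\
  (\sum_(x : bvec l.+2) xlnx (embed_num y x)%:R = bound <->
    y = zeros l \/ y = ones l).
Proof.
move=> l0 bound; set b := l.+1; set c := 'C(l.+2, 2).
have binl : 'C(l.+2, l) = c by rewrite -[X in 'C(_, X)](addnK 2 l) addn2 bin_sub.
have cE : (c = 'C(l.+1, 2) + b)%N by rewrite /c binS bin1.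
have c2 : (c.*2 = l.+2 * l.+1)%N by rewrite -muln2 mulnC /c -(mul_bin_diag l.+2 1) bin1.
have b1 : (1 < b)%N by [].
have bc : (b < c)%N by rewrite cE -addn1 addnC leq_add2r bin_gt0.
pose s1 := slope1 R b; pose s2 := slope2 R b c.
pose chords (w : nat) : R := s1 * (w - (0 < w))%N%:R + s2 * (w - b)%N%:R.
pose excess := (\sum_(x : bvec l.+2) (embed_num y x - b))%N.
have excess_le : (excess <= c - b)%N by rewrite cE addnK; apply: sum_embed_num_excess2.
have le_c (x : bvec l.+2) : (embed_num y x <= c)%N by rewrite -binl leq_embed_num_bin.
have sumT : (\sum_(x : bvec l.+2) embed_num y x = 4 * c)%N.
  apply/eqP; rewrite -(@eqn_pmul2r (2 ^ l)) ?expn_gt0 // big_distrl /=.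
  by rewrite sum_embed_num binl !expnS; apply/eqP; lia.
have sumS : (\sum_(x : bvec l.+2) (0 < embed_num y x) = c + l + 3)%N.
  rewrite sum_embed_num_gt0 3?big_nat_recr //=; try lia.
  by rewrite big_geq // binl binSn binn; lia.
(* The difference [4c - (c + l + 3)], rearranged by [2c = (l + 2)(l + 1)] into the contributions of
   one value [c] and [l.+2] values [b]. *)
have sum1 : (\sum_(x : bvec l.+2) (embed_num y x - (0 < embed_num y x)) =
    (c - 1) + l.+2 * (b - 1))%N.
  have : (\sum_(x : bvec l.+2) (embed_num y x - (0 < embed_num y x)) +
      \sum_(x : bvec l.+2) (0 < embed_num y x) = \sum_(x : bvec l.+2) embed_num y x)%N.
    rewrite -big_split /=; apply: eq_bigr => x _.
    by case: (embed_num y x) => // e; rewrite subn1 addn1.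
  by rewrite sumT sumS /b; nia.
(* The broken line sums to [bound] up to the amount by which [excess] falls short of [c - b]. *)
have sum_chords : \sum_(x : bvec l.+2) chords (embed_num y x) =
    bound - s2 * ((c - b) - excess)%N%:R.
  rewrite big_split /= -!mulr_sumr -!natr_sum sum1 -/excess natrB // mulrBr.
  rewrite /bound -/b -/c (xlnx_eq_chords _ _ _ b1 bc b) ?inE ?eqxx ?orbT //.
  rewrite (xlnx_eq_chords _ _ _ b1 bc c) ?inE ?eqxx ?orbT //.
  by rewrite subnn (ltnW b1) (ltnW (ltn_trans b1 bc)) natrD natrM -/s1 -/s2; ring.
have s2_gt0 : 0 < s2 by apply: slope2_gt0.
have le_chords (x : bvec l.+2) : xlnx (embed_num y x)%:R <= chords (embed_num y x).
  exact: xlnx_le_chords.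
have sum_le : \sum_(x : bvec l.+2) xlnx (embed_num y x)%:R <=
    \sum_(x : bvec l.+2) chords (embed_num y x) by apply: ler_sum.
have chords_le : \sum_(x : bvec l.+2) chords (embed_num y x) <= bound.
  by rewrite sum_chords gerBl mulr_ge0 // ltW.
split; first exact: le_trans sum_le chords_le.
split=> [eq_bound|const].
  (* As [s2 > 0], equality leaves no shortfall; the excess is then positive, so some [x] exceeds
     [b]. *)
  have excess_eq : excess = (c - b)%N.
    have : s2 * ((c - b) - excess)%N%:R <= 0.
      by move: sum_le; rewrite sum_chords eq_bound lerBrDl gerDr.
    rewrite pmulr_rle0 // lern0 subn_eq0 => le_excess.
    by apply/eqP; rewrite eqn_leq excess_le.
  have [x bx] : exists x : bvec l.+2, (b < embed_num y x)%N.
    apply/existsP; apply: contraTT bc => /existsPn no_excess.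
    have : excess == 0%N.
      rewrite sum_nat_eq0; apply/forallP => x.
      by rewrite /= subn_eq0 leqNgt no_excess.
    by rewrite excess_eq subn_eq0 -leqNgt.
  apply: (embed_num_full _ x); apply/eqP; rewrite binl eqn_leq le_c leqNgt.
  (* A value strictly between [b] and [c] would leave a positive gap below the broken line, but the
     nonnegative gaps sum to zero. *)
  apply/negP => xc; have : xlnx (embed_num y x)%:R < chords (embed_num y x).
    by apply: xlnx_lt_chords => //; rewrite bx.
  apply/negP; rewrite -leNgt.
  have : \sum_(z : bvec l.+2) (chords (embed_num y z) - xlnx (embed_num y z)%:R) == 0.
    by rewrite sumrB sum_chords excess_eq subnn mulr0 subr0 eq_bound subrr.
  rewrite psumr_eq0 => [|z _]; last by rewrite subr_ge0.
  by move/allP/(_ x (mem_index_enum x)); rewrite subr_eq0 => /eqP->.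
have [a ya] : exists a, y = [ffun=> a] by case: const => ->; [exists false|exists true].
(* The constant [x] with the same letter as [y] alone supplies [c - b]. *)
have excess_ge : (c - b <= excess)%N.
  rewrite /excess (bigD1 [ffun=> a]) //= ya embed_num_const.
  under eq_bigr do rewrite ffunE eqxx.
  by rewrite sum1_card card_ord binl leq_addr.
apply/eqP; rewrite eq_le (le_trans sum_le chords_le) /=.
have -> : bound = \sum_(x : bvec l.+2) chords (embed_num y x).
  by rewrite sum_chords (eqP excess_ge) mulr0 subr0.
apply: ler_sum => x _; rewrite (xlnx_eq_chords R b c b1 bc) //.
by rewrite ya embed_num_const_values.
Qed.

(** * From the entropy to the sum of [w ln w] *)

(** The embedding numbers sum to [2 ^ k * 'C(n, k)], so the posterior is [w] over this total;
    expanding the logarithm of the quotient separates the constant term. *)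
Lemma input_entropyE (R : realType) n k (y : bvec (n - k)) : (k <= n)%N ->
  input_entropy y = log2 ((2 ^ k * 'C(n, k))%N%:R : R) -
    (\sum_(x : bvec n) xlnx (embed_num y x)%:R) / ((2 ^ k * 'C(n, k))%N%:R * ln 2).
Proof.
move=> kn; set T := (2 ^ k * 'C(n, k))%N.
have C0 : ('C(n, k))%:R != 0 :> R by rewrite pnatr_eq0 -lt0n bin_gt0.
have T0 : T%:R != 0 :> R by rewrite pnatr_eq0 -lt0n muln_gt0 expn_gt0 bin_gt0.
have sumT : (\sum_(x : bvec n) embed_num y x = T)%N.
  apply/eqP; rewrite -(@eqn_pmul2r (2 ^ (n - k))) ?expn_gt0 // big_distrl /=.
  rewrite sum_embed_num bin_sub //.
  have -> : (2 ^ n = 2 ^ k * 2 ^ (n - k))%N by rewrite -expnD subnKC.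
  by rewrite /T; apply/eqP; ring.
have postE (x : bvec n) : post_prob (R := R) y x = (embed_num y x)%:R / T%:R.
  rewrite /post_prob /del_prob -mulr_suml -natr_sum sumT.
  by field; rewrite T0 C0.
rewrite /input_entropy; under eq_bigr => x _ do rewrite /= postE.
have -> : \sum_(x : bvec n) (if (embed_num y x)%:R / T%:R == 0 :> R then 0
      else (embed_num y x)%:R / T%:R * log2 ((embed_num y x)%:R / T%:R)) =
    \sum_(x : bvec n) (xlnx (embed_num y x)%:R / (T%:R * ln 2) -
      (embed_num y x)%:R * (log2 T%:R / T%:R)) :> R.
  apply: eq_bigr => x _; rewrite /xlnx; have [->|e0] := posnP (embed_num y x).
    by rewrite !mul0r eqxx subr0.
  rewrite mulf_eq0 invr_eq0 (negbTE T0) orbF pnatr_eq0 gtn_eqF //.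
  rewrite /log2 ln_div ?posrE ?ltr0n //; last by rewrite lt0n -(pnatr_eq0 R).
  have : ln 2 != 0 :> R by rewrite gt_eqF // ln_gt0 ?ltr1n.
  by move=> ln2; field; rewrite T0 ln2.
rewrite sumrB -mulr_suml -mulr_suml -natr_sum sumT.
by field; rewrite T0 gt_eqF // ln_gt0 ?ltr1n.
Qed.

Theorem theorem9 (R : realType) (n : nat) (hn : (3 <= n)%N) :
  let m := (n - 2)%N in
  let minval : R :=
    2 + 3 / 4 * log2 ('C(m + 2, 2)%N)%:R - 1 / 2 * log2 (m + 1)%N%:R in
  (forall y : bvec (n - 2)%N, minval <= input_entropy (R := R) (n := n) (k := 2) y) /\
  (forall y : bvec (n - 2)%N,
     input_entropy (R := R) (n := n) (k := 2) y = minval <-> (y = zeros (n - 2)%N \/ y = ones (n - 2)%N)).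

Proof.
move=> m minval.
have mE : n = m.+2 by rewrite /m; lia.
have m0 : (0 < m)%N by rewrite /m; lia.
have c0 : (0 < 'C(m.+2, 2))%N by rewrite bin_gt0.
have ln2 : ln 2 != 0 :> R by rewrite gt_eqF // ln_gt0 ?ltr1n.
pose bound : R := xlnx ('C(m.+2, 2))%:R + m.+2%:R * xlnx m.+1%:R.
pose T : R := 4 * ('C(m.+2, 2))%:R * ln 2.
have T0 : 0 < T by rewrite !mulr_gt0 ?ltr0n // ln_gt0 ?ltr1n.
have bin2 : m.+2%:R * m.+1%:R = 2 * ('C(m.+2, 2))%:R :> R.
  by rewrite -!natrM -(mul_bin_diag m.+2 1) bin1.
(* By [bin2], [bound / T] is [1/4 log2 C + 1/2 log2 (m + 1)] with [C = 'C(m.+2, 2)], while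
   [log2 (4 C) = 2 + log2 C]. *)
have minvalE : minval = log2 (4 * ('C(m.+2, 2))%:R) - bound / T.
  have -> : bound = ('C(m.+2, 2))%:R * (ln ('C(m.+2, 2))%:R + 2 * ln m.+1%:R).
    by rewrite /bound /xlnx mulrA bin2; ring.
  have C0 : ('C(m.+2, 2))%:R != 0 :> R by rewrite pnatr_eq0 -lt0n.
  have -> : (4 : R) = 2 * 2 by rewrite -natrM.
  rewrite /minval /T /log2 addn1 addn2 !lnM ?posrE ?mulr_gt0 ?ltr0n //.
  by field; rewrite ln2 C0.
have entropyE (y : bvec (n - 2)) : input_entropy (R := R) y =
    log2 (4 * ('C(m.+2, 2))%:R) - (\sum_(x : bvec n) xlnx (embed_num y x)%:R) / T.
  rewrite input_entropyE; last exact: ltnW.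
  by rewrite /T natrM [in 'C(n, 2)]mE.
have main (y : bvec (n - 2)) : \sum_(x : bvec n) xlnx (embed_num y x)%:R <= bound /\
    (\sum_(x : bvec n) xlnx (embed_num y x)%:R = bound <->
     y = zeros (n - 2) \/ y = ones (n - 2)).
  (* Folding [n - 2] into [m] first makes the rewriting of [n] affect only the length of [x]. *)
  move: y; rewrite /bound -/m; move: mE => ->.
  by move=> y; apply: sum_xlnx_embed_num.
split=> y; have [le_b eq_b] := main y.
  by rewrite minvalE entropyE lerD2l lerN2 ler_pM2r ?invr_gt0.
rewrite minvalE entropyE -eq_b; split=> [|->//].
by move=> /addrI/oppr_inj/mulIf; apply; rewrite invr_eq0 gt_eqF.
Qed.
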